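(* Let $A^{*}$ be a Hurwitz algebra over a field $F$ of characteristic $\neq 2$ with unit element $e$ and bilinear product $x*y$. For any $a\in A^{*}$ satisfying $\langle a|a\rangle=1$ and $2\langle e|a\rangle=-1$, set $$\sigma(a)=l(\bar a)r(a)=r(a)l(\bar a).$$ Then for all $x,y\in A^{*}$: (i) $\overline{\sigma(a)}(x*y)=(\sigma(a)x)*(\sigma(a)y)$; (ii) $\sigma(a)\sigma(\bar a)=\mathrm{Id}$; (iii) $(\sigma(a))^{3}=\mathrm{Id}$; (iv) $\langle\sigma(a)x|\sigma(a)y\rangle=\langle x|y\rangle$. Especially, $\sigma(a)\in\mathrm{Auto}(A^{*})$.
   Context: A Hurwitz algebra is a unital composition algebra: a (not necessarily associative) $F$-algebra $A^{*}$ with product $x*y$, unit $e$, and a non-degenerate symmetric bilinear form $\langle\cdot|\cdot\rangle$ with $\langle x*y|x*y\rangle=\langle x|x\rangle\langle y|y\rangle$. Its standard involution is $\bar x=2\langle e|x\rangle e-x$. The multiplication operators are $l(x)y=x*y$, $r(x)y=y*x$. For a linear map $Q:A^{*}\to A^{*}$, the map $\overline{Q}$ is defined by $\overline{Q}\,\bar x=\overline{Qx}$ for all $x$. $\mathrm{Auto}(A^{*})$ is the group of algebra automorphisms of $(A^{*},* )$. (In the paper, $A^*$ is the conjugate of the symmetric composition algebra with product $xy=\overline{x*y}$.) *)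

(* Defs.v *)
From HB Require Import structures.
From mathcomp Require Import all_boot all_algebra.

Set Implicit Arguments.
Unset Strict Implicit.
Unset Printing Implicit Defensive.

Import GRing.Theory.
Local Open Scope ring_scope.

(* The product is not assumed associative, nor the dimension finite; the      *)
(* library's [nondegenerate] needs a finite-dimensional space, hence the      *)
(* explicit non-degeneracy condition below.                                   *)
HB.mixin Record isHurwitz (F : fieldType) A of GRing.Lmodule F A := {
  hmul : {bilinear A -> A -> A};
  hform : {symmetric A};
  hone : A;
  hmul1x : left_id hone hmul;
  hmulx1 : right_id hone hmul;
  hform_nondeg : forall x : A, (forall y, hform x y = 0) -> x = 0;
  hform_comp : forall x y : A,
    hform (hmul x y) (hmul x y) = hform x x * hform y y
}.

#[short(type="hurwitzType")]
HB.structure Definition Hurwitz (F : fieldType) :=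
  { A of GRing.Lmodule F A & isHurwitz F A }.

Declare Scope hurwitz_scope.
Delimit Scope hurwitz_scope with H.

Notation "x *h y" := (hmul x y)
  (at level 40, left associativity) : hurwitz_scope.
Notation "''<' x | y '>'" := (hform x y)
  (at level 0, x at level 69, y at level 69,
   format "''<' x  |  y '>'") : hurwitz_scope.

Local Open Scope hurwitz_scope.

Section HurwitzOperators.
Variables (F : fieldType) (A : hurwitzType F).
Implicit Types (x y a : A) (Q : A -> A).

Definition hconj x : A := (2 * '<hone | x>) *: hone - x.

Definition lop x : A -> A := fun y => x *h y.
Definition rop x : A -> A := fun y => y *h x.

(* Since [hconj] is an involution (in characteristic not 2), this is the only *)
(* map sending [hconj x] to [hconj (Q x)] for all [x]; see [opconjP].         *)
Definition opconj Q : A -> A := fun x => hconj (Q (hconj x)).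

Definition sigma a : A -> A := lop (hconj a) \o rop a.

Definition is_auto Q : Prop :=
  [/\ linear Q, bijective Q & forall x y, Q (x *h y) = Q x *h Q y].

Lemma hformC x y : '<x | y> = '<y | x>.
Proof. by rewrite hermC expr0 mul1r. Qed.

Lemma hform11 : (2 \notin [pchar F])%N -> (exists x : A, x != 0) ->
  '<hone : A | hone> = 1.
Proof.
move=> char2 [x0 x0n0].
have n2 : (2 : F) != 0 by move: char2; rewrite inE /=.
have E x : '<x | x> = '<hone : A | hone> * '<x | x>.
  by rewrite -hform_comp hmul1x.
have [z|nz] := eqVneq '<hone : A | hone> 0; last first.
  by apply: (mulfI nz); rewrite mulr1 -E.
case/eqP: x0n0; apply: hform_nondeg => y.
have Z x : '<x | x> = 0 by rewrite E z mul0r.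
have := Z (x0 + y); rewrite linearDr /= linearDl /= linearDl /= !Z.
rewrite add0r addr0 (hformC y) -mulr2n -mulr_natl => /eqP.
by rewrite mulf_eq0 (negbTE n2) => /eqP.
Qed.

Lemma hconjK : (2 \notin [pchar F])%N -> involutive (@hconj).
Proof.
move=> char2 x; have [->|x0] := eqVneq x 0.
  by rewrite /hconj linear0r mulr0 scale0r subr0 linear0r mulr0 scale0r subr0.
rewrite /hconj linearBr /= linearZr_LR /= hform11 //; last by exists x.
set t := '<hone | x>; have -> : 2 * t * 1 - t = t.
  by rewrite mulr1 mulr_natl mulr2n addrK.
by rewrite opprB addrC subrK.
Qed.

Lemma opconjP (Q R : A -> A) : (2 \notin [pchar F])%N ->
  (forall x, R (hconj x) = hconj (Q x)) <-> R =1 opconj Q.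
Proof.
move=> char2; split=> [RQ x|RQ x]; last by rewrite RQ /opconj hconjK.
by rewrite /opconj -RQ hconjK.
Qed.

End HurwitzOperators.

(* Main.v *)
(* Polarizing <xy|xy> = <x|x><y|y> makes l(conj x) adjoint to l(x) and r(conj x)
   adjoint to r(x), so by non-degeneracy
     x(y u) + conj y (conj x u) = 2 <conj x|y> u,
   together with its mirror image.  For u = x w the second term collapses to
   <x|x> (conj y) w, and comparing with the case w = 1 gives the left Moufang
   identity x(y(xw)) = (x(yx))w; the mirror image gives the right one.
   When b := conj a has norm 1 and trace -1, b is the inverse of a and b^2 = a,
   so the left Moufang identity gives b(xy) = (bxb)(ay), the right one gives
   (pq)a = (pb)(aqa), and composing the two yields
     b(xy)a = (b x b^2)(a^2 y a) = (b x a)(b y a). *)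
Require Import Defs.
From HB Require Import structures.
From mathcomp Require Import all_boot all_algebra.

Set Implicit Arguments.
Unset Strict Implicit.
Unset Printing Implicit Defensive.

Import GRing.Theory.
Local Open Scope ring_scope.
Local Open Scope hurwitz_scope.

Section HurwitzTheory.
Variables (F : fieldType) (A : hurwitzType F).
Hypothesis char2 : (2 \notin [pchar F])%N.
Implicit Types (x y z w u a b p q : A).

Let two_neq0 : (2 : F) != 0. Proof. by move: char2; rewrite inE. Qed.

(** * Bilinearity and non-degeneracy *)

Lemma hmulDl x y z : (x + y) *h z = x *h z + y *h z.
Proof. exact: linearDl. Qed.

Lemma hmulDr x y z : x *h (y + z) = x *h y + x *h z.
Proof. exact: linearDr. Qed.

Lemma hmulNl x y : (- x) *h y = - (x *h y).
Proof. exact: linearNl. Qed.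

Lemma hmulNr x y : x *h (- y) = - (x *h y).
Proof. exact: linearNr. Qed.

Lemma hmulZl k x y : (k *: x) *h y = k *: (x *h y).
Proof. exact: linearZl_LR. Qed.

Lemma hmulZr k x y : x *h (k *: y) = k *: (x *h y).
Proof. exact: linearZr_LR. Qed.

Lemma hformDr x y z : '<x | y + z> = '<x | y> + '<x | z>.
Proof. exact: linearDr. Qed.

Lemma hformDl x y z : '<x + y | z> = '<x | z> + '<y | z>.
Proof. by rewrite hformC hformDr !(hformC z). Qed.

Lemma hformNl x y : '<- x | y> = - '<x | y>.
Proof. by rewrite hformC linearNr hformC. Qed.

Lemma hformZl k x y : '<k *: x | y> = k * '<x | y>.
Proof. by rewrite hformC linearZr_LR hformC. Qed.

Lemma hform_inj x y : (forall w, '<x | w> = '<y | w>) -> x = y.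
Proof.
move=> E; apply/eqP; rewrite -subr_eq0; apply/eqP; apply: hform_nondeg => w.
by rewrite hformDl hformNl E subrr.
Qed.

(** * Polarized composition law and adjoints of multiplications *)

Lemma hform_mulr x y z : '<x *h z | y *h z> = '<x | y> * '<z | z>.
Proof.
have := hform_comp (x + y) z.
rewrite hmulDl !hformDl !hformDr !hform_comp !mulrDl.
rewrite (hformC (y *h z) (x *h z)) (hformC y x) -!addrA => /addrI.
rewrite !addrA => /addIr; rewrite -!mulr2n => E.
(* The diagonal terms have cancelled, leaving twice the identity. *)
by apply: (mulfI two_neq0); rewrite !mulr_natl.
Qed.

Lemma hform_mul4 x y z w :
  '<x *h z | y *h w> + '<x *h w | y *h z> = 2 * '<x | y> * '<z | w>.
Proof.
have := hform_mulr x y (z + w).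
rewrite !hmulDr !hformDl !hformDr !hform_mulr !mulrDr (hformC w z) -!addrA.
move=> /addrI; rewrite !addrA => /addIr ->.
by rewrite -mulrA mulr_natl mulr2n.
Qed.

(** This is [hform_mul4] with one argument the unit: the right-hand term there becomes the scalar
    part of [hconj x]. *)
Lemma hform_lmul x y w : '<x *h y | w> = '<y | hconj x *h w>.
Proof.
have := hform_mul4 x hone y w.
rewrite !hmul1x (hformC x) => /(canRL (addrK _)) ->.
by rewrite /hconj hmulDl hmulNl hmulZl hmul1x [RHS]hformC hformDl hformNl
  hformZl (hformC w y).
Qed.

Lemma hform_rmul x y w : '<y *h x | w> = '<y | w *h hconj x>.
Proof.
have := hform_mul4 y w x hone.
rewrite !hmulx1 (hformC x hone) mulrAC => /(canRL (addrK _)) ->.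
by rewrite /hconj hmulDr hmulNr hmulZr hmulx1 [RHS]hformC hformDl hformNl
  hformZl (hformC w y) (hformC (w *h x)).
Qed.

Lemma hform_mulone x y : '<hone | x *h y> = '<hconj x | y>.
Proof. by rewrite hformC hform_lmul hmulx1 hformC. Qed.

Lemma hform_mulone_r x y : '<hone | x *h y> = '<hconj y | x>.
Proof. by rewrite hformC hform_rmul hmul1x hformC. Qed.

(** The adjoint rules turn both pairings with [w] into that of [x] with [hconj w *h hconj y]. *)
Lemma hconjM x y : hconj (x *h y) = hconj y *h hconj x.
Proof.
apply: hform_inj => w; rewrite -hform_mulone_r hform_mulone.
by rewrite !hform_rmul hconjK // [RHS]hformC hform_lmul hformC hform_rmul.
Qed.

Lemma hform_conj x y : '<hconj x | hconj y> = '<x | y>.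
Proof. by rewrite -hform_mulone_r hform_mulone hconjK // hformC. Qed.

(** Conjugation is an isometric anti-automorphism, so it mirrors [hform_mulr]. *)
Lemma hform_mull x y z : '<z *h x | z *h y> = '<z | z> * '<x | y>.
Proof. by rewrite -hform_conj !hconjM hform_mulr !hform_conj mulrC. Qed.

Lemma lmul_conjK x u : hconj x *h (x *h u) = '<x | x> *: u.
Proof.
by apply: hform_inj => w; rewrite hform_lmul hconjK // hform_mull hformZl.
Qed.

Lemma rmul_conjK x u : (u *h x) *h hconj x = '<x | x> *: u.
Proof.
apply: hform_inj => w.
by rewrite hform_rmul hconjK // hform_mulr hformZl mulrC.
Qed.

Lemma lmul_conj_polar x y u :
  x *h (y *h u) + hconj y *h (hconj x *h u) = (2 * '<hconj x | y>) *: u.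
Proof.
apply: hform_inj => w.
rewrite hformDl hformZl (hform_lmul x) (hform_lmul (hconj y)) hconjK //.
by rewrite (hformC (hconj x *h u)) hform_mul4 (hformC y).
Qed.

Lemma rmul_conj_polar x y u :
  (u *h y) *h x + (u *h hconj x) *h hconj y = (2 * '<hconj x | y>) *: u.
Proof.
apply: hform_inj => w.
rewrite hformDl hformZl (hform_rmul x) (hform_rmul (hconj y)) hconjK //.
by rewrite hform_mul4 (hformC y) mulrAC.
Qed.

(** * Flexible and Moufang identities *)

Lemma lmul_mul_lmul b x w :
  b *h (x *h (b *h w)) =
    (2 * '<hconj b | x>) *: (b *h w) - '<b | b> *: (hconj x *h w).
Proof.
have /(canRL (addrK _)) -> := lmul_conj_polar b x (b *h w).
by rewrite lmul_conjK hmulZr.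
Qed.

Lemma rmul_mul_rmul b x w :
  ((w *h b) *h x) *h b =
    (2 * '<hconj b | x>) *: (w *h b) - '<b | b> *: (w *h hconj x).
Proof.
have /(canRL (addrK _)) -> := rmul_conj_polar b x (w *h b).
by rewrite rmul_conjK hmulZl.
Qed.

(** At [w := hone] both triple products reduce to the same combination of [b] and [hconj x]. *)
Lemma hmul_flexible b x : b *h (x *h b) = (b *h x) *h b.
Proof.
have := lmul_mul_lmul b x hone; have := rmul_mul_rmul b x hone.
by rewrite !hmulx1 !hmul1x => -> ->.
Qed.

Lemma left_moufang b x w : b *h (x *h (b *h w)) = (b *h (x *h b)) *h w.
Proof.
have := lmul_mul_lmul b x hone; rewrite !hmulx1 => ->.
by rewrite lmul_mul_lmul [RHS]hmulDl hmulNl !hmulZl.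
Qed.

Lemma right_moufang b x w : ((w *h b) *h x) *h b = w *h (b *h (x *h b)).
Proof.
have := rmul_mul_rmul b x hone; rewrite !hmul1x hmul_flexible => ->.
by rewrite rmul_mul_rmul [RHS]hmulDr hmulNr !hmulZr.
Qed.

(** Since [hconj a] is a combination of the unit and [a], flexibility suffices. *)
Lemma lop_conj_rop a x : hconj a *h (x *h a) = (hconj a *h x) *h a.
Proof.
by rewrite /hconj !hmulDl !hmulNl !hmulZl !hmul1x hmul_flexible.
Qed.

(** Conjugation reverses products, so it swaps the roles of [lop (hconj a)] and [rop a], which
    commute. Claim (i) thus becomes plain multiplicativity. *)
Lemma opconj_sigma a : opconj (sigma a) =1 sigma a.
Proof.
move=> x; rewrite /opconj /sigma /= /lop /rop !hconjM !hconjK //.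
by rewrite lop_conj_rop.
Qed.

(** * Elements of norm 1 and trace -1 *)

Section CubeRoot.
Variable a : A.
Hypotheses (norm_a : '<a | a> = 1) (trace_a : 2 * '<hone | a> = -1).

Lemma hconj_unitE : hconj a = - hone - a.
Proof. by rewrite /hconj trace_a scaleN1r. Qed.

Lemma lconjK u : hconj a *h (a *h u) = u.
Proof. by rewrite lmul_conjK norm_a scale1r. Qed.

Lemma lmulKconj u : a *h (hconj a *h u) = u.
Proof.
have := lmul_conjK (hconj a) u.
by rewrite hconjK // hform_conj norm_a scale1r.
Qed.

Lemma rmulKconj u : (u *h hconj a) *h a = u.
Proof.
have := rmul_conjK (hconj a) u.
by rewrite hconjK // hform_conj norm_a scale1r.
Qed.

(** With b = [hconj a] = -1 - a, one gets b(bu) = -bu - a(bu) = -bu - u = au. *)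
Lemma lconj_sq u : hconj a *h (hconj a *h u) = a *h u.
Proof.
have bE v : hconj a *h v = - v - a *h v.
  by rewrite hconj_unitE hmulDl !hmulNl hmul1x.
by rewrite bE lmulKconj bE opprB opprK addrK.
Qed.

Lemma lsq u : a *h (a *h u) = hconj a *h u.
Proof. by rewrite -(lconj_sq (a *h u)) lconjK. Qed.

Lemma rsq u : (u *h a) *h a = u *h hconj a.
Proof.
by apply: (can_inj (hconjK char2)); rewrite !hconjM lconj_sq hconjK.
Qed.

Lemma sigmaE x : sigma a x = (hconj a *h x) *h a.
Proof. by rewrite -lop_conj_rop. Qed.

Lemma sigmaM x y : sigma a (x *h y) = sigma a x *h sigma a y.
Proof.
(* Left Moufang applies after writing y as [hconj a *h (a *h y)]. *)
have bxyE : hconj a *h (x *h y) = (hconj a *h (x *h hconj a)) *h (a *h y).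
  by rewrite -left_moufang lconjK.
(* The trailing [hconj a] is split into two right multiplications by [a], so that right Moufang can
   absorb one. *)
have pE : hconj a *h (x *h hconj a) = sigma a x *h a.
  by rewrite sigmaE rsq hmul_flexible.
have qE : a *h ((a *h y) *h a) = sigma a y.
  by rewrite hmul_flexible lsq sigmaE.
by rewrite [LHS]sigmaE bxyE pE right_moufang qE.
Qed.

Lemma sigma_conjK x : sigma a (sigma (hconj a) x) = x.
Proof.
rewrite /sigma /= /lop /rop hconjK // lop_conj_rop lconjK.
by rewrite rmulKconj.
Qed.

(** Squaring turns [lop (hconj a)] into [lop a] and [rop a] into [rop (hconj a)]; with [sigma_conjK]
    this gives order dividing 3. *)
Lemma sigma_sq x : sigma a (sigma a x) = sigma (hconj a) x.
Proof.
rewrite {2}/sigma /= /lop /rop sigmaE lconj_sq.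
by rewrite -hmul_flexible rsq /sigma /= /lop /rop hconjK.
Qed.

Lemma hform_sigma x y : '<sigma a x | sigma a y> = '<x | y>.
Proof. by rewrite hform_mull hform_mulr hform_conj norm_a mul1r mulr1. Qed.

End CubeRoot.
End HurwitzTheory.

Theorem corollary4p2 (F : fieldType) (A : hurwitzType F) (a : A)
    (charF : (2 \notin [pchar F])%N)
    (norm_a : '<a | a> = 1)
    (trace_a : 2 * '<hone | a> = -1) :
  lop (hconj a) \o rop a =1 rop a \o lop (hconj a) /\
  (forall x y : A,
      opconj (sigma a) (x *h y) = sigma a x *h sigma a y) /\
  sigma a \o sigma (hconj a) =1 id /\
  iter 3 (sigma a) =1 id /\
  (forall x y : A, '<sigma a x | sigma a y> = '<x | y>) /\
  is_auto (sigma a).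
Proof.
have sigmaK : iter 3 (sigma a) =1 id.
  by move=> x /=; rewrite [sigma a (sigma a x)]sigma_sq // sigma_conjK.
split; first by move=> x /=; rewrite /lop /rop lop_conj_rop.
split; first by move=> x y; rewrite opconj_sigma // sigmaM.
split; first by move=> x /=; rewrite sigma_conjK.
split=> //; split; first by move=> x y; rewrite hform_sigma.
split; last exact: sigmaM.
  move=> k x y; rewrite /sigma /= /lop /rop.
  by rewrite (hmulDl (k *: x)) hmulDr (hmulZl k x) hmulZr.
(* As the cube is the identity, the square is a two-sided inverse. *)
by exists (sigma a \o sigma a) => x; apply: sigmaK.
Qed.
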